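(* Let $p \in \{0\} \cup [1,\infty)$, let $A := (a_{j,k})_{j \in \mathbb{Z}, k \in \mathbb{N}}$ be a Köthe matrix on $\mathbb{Z}$ with nonzero entries, and consider the Köthe sequence space $X := \lambda_p(A,\mathbb{Z})$. Let $w := (w_n)_{n \in \mathbb{Z}}$ be a sequence of nonzero scalars such that the bilateral weighted backward shift $B_w$ is a well-defined operator on $X$. Then $B_w$ is Li-Yorke chaotic if and only if the following conditions hold: (a) There is an increasing sequence $(n_i)_{i \in \mathbb{N}}$ of positive integers such that $\lim_{i \to \infty} a_{-n_i,k}\, w_{-n_i} \cdots w_{-1} = 0$ for all $k \in \mathbb{N}$. (b) There exists $k \in \mathbb{N}$ such that $$\sup\Big\{\frac{a_{i,k} |w_i \cdots w_j|}{a_{j+1,\ell}} : i,j \in \mathbb{Z}, i \leq j\Big\} = \infty \ \text{ for all } \ell \in \mathbb{N}.$$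
   Context: $\mathbb{K}$ denotes $\mathbb{R}$ or $\mathbb{C}$ (the scalar field), and $\mathbb{N} = \{1,2,3,\ldots\}$. A Köthe matrix on $\mathbb{Z}$ is a family of scalars $A = (a_{j,k})_{j \in \mathbb{Z},k\in\mathbb{N}}$ such that for each $j$ there is $k$ with $a_{j,k} > 0$, and $0 \leq a_{j,k} \leq a_{j,k+1}$ for all $j,k$. The Köthe sequence space $\lambda_p(A,\mathbb{Z})$ is the Fréchet space defined as follows. If $p \in [1,\infty)$, it is $\{(x_j)_{j} \in \mathbb{K}^{\mathbb{Z}} : \sum_{j \in \mathbb{Z}} |a_{j,k}x_j|^p < \infty \text{ for all } k \in \mathbb{N}\}$ with the seminorms $\|x\|_k := (\sum_{j\in\mathbb{Z}} |a_{j,k}x_j|^p)^{1/p}$, $k \in \mathbb{N}$. If $p = 0$, it is $\{(x_j)_j \in \mathbb{K}^{\mathbb{Z}} : \lim_{|j| \to \infty} a_{j,k}x_j = 0 \text{ for all } k \in \mathbb{N}\}$ with the seminorms $\|x\|_k := \sup_{j\in\mathbb{Z}} |a_{j,k}x_j|$, $k \in \mathbb{N}$. The bilateral weighted backward shift is $B_w((x_n)_{n\in\mathbb{Z}}) := (w_n x_{n+1})_{n \in \mathbb{Z}}$; it is a well-defined operator on $X$ if it maps $X$ into itself (it is then automatically continuous). For $i \leq j$, $w_i\cdots w_j$ denotes the product of all $w_l$ with $i \leq l \leq j$. ''Increasing sequence of positive integers'' means strictly increasing. A continuous map $g : M \to M$ on a metric space $(M,d)$ is Li-Yorke chaotic if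 there is an uncountable set $S \subset M$ such that for all distinct $x,y \in S$, $\liminf_{n \to \infty} d(g^n(x),g^n(y)) = 0$ and $\limsup_{n\to\infty} d(g^n(x),g^n(y)) > 0$. A Fréchet space is regarded as a metric space via any translation-invariant metric inducing its topology. *)

(* Defs.v *)
From HB Require Import structures.
From mathcomp Require Import all_boot all_order all_algebra.
From mathcomp Require Import all_classical all_reals all_analysis.
From mathcomp Require Import complex.

Set Implicit Arguments.
Unset Strict Implicit.
Unset Printing Implicit Defensive.

Import Order.TTheory GRing.Theory Num.Theory.
Import numFieldTopology.Exports numFieldNormedType.Exports.

Local Open Scope classical_set_scope.
Local Open Scope ring_scope.

(* The scalar field is R or R[i].  As the library norm of R[i] takes its values
   in R[i], we use the R-valued modulus instead. *)
Variant scalar_kind := RealScalars | ComplexScalars.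

Definition scalar_field (R : realType) (c : scalar_kind) : numFieldType :=
  match c with RealScalars => R | ComplexScalars => R[i] end.

Definition of_real (R : realType) (c : scalar_kind) : R -> scalar_field R c :=
  match c with
  | RealScalars => fun a => a
  | ComplexScalars => fun a => real_complex R a
  end.

Definition modulus (R : realType) (c : scalar_kind) : scalar_field R c -> R :=
  match c with
  | RealScalars => fun x : R => `|x|
  | ComplexScalars => fun z : R[i] => ComplexField.Normc.normc z
  end.

(* The level k = 1, 2, ... of the matrix is encoded as k - 1 : nat. *)
Definition koethe_matrix (R : realType) (A : int -> nat -> R) : Prop :=
  (forall j, exists k, 0 < A j k) /\
  (forall j k, 0 <= A j k /\ A j k <= A j k.+1).

Section KoetheSpace.
Context (R : realType) (c : scalar_kind) (p : R) (A : int -> nat -> R).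
Local Notation K := (scalar_field R c).

Definition weighted_abs (k : nat) (x : int -> K) (j : int) : R :=
  modulus (of_real c (A j k) * x j).

(* Only p = 0 and 1 <= p are meaningful. *)
Definition koethe_space : set (int -> K) :=
  [set x | forall k : nat,
    if p == 0 then
      forall e : R, 0 < e ->
        exists N : nat, forall j : int, (N <= `|j|)%N -> weighted_abs k x j < e
    else (\esum_(j in [set: int]) (weighted_abs k x j `^ p)%:E < +oo)%E].

Definition koethe_seminorm (k : nat) (x : int -> K) : \bar R :=
  if p == 0 then ereal_sup (range (fun j : int => (weighted_abs k x j)%:E))
  else ((\esum_(j in [set: int]) (weighted_abs k x j `^ p)%:E) `^ p^-1)%E.

(* U is a neighbourhood of x, relative to the Koethe space, for the topology
   defined by the family of all the seminorms. *)
Definition koethe_nbhs (x : int -> K) (U : set (int -> K)) : Prop :=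
  exists (m : nat) (e : R), 0 < e /\
    forall y, koethe_space y ->
      (forall k, (k <= m)%N -> (koethe_seminorm k (y - x)%R < e%:E)%E) -> U y.

End KoetheSpace.

Definition metric_on (R : realType) (T : Type) (M : set T) (d : T -> T -> R) :
    Prop :=
  [/\ forall x y, M x -> M y -> 0 <= d x y,
      forall x y, M x -> M y -> (d x y = 0 <-> x = y),
      forall x y, M x -> M y -> d x y = d y x
    & forall x y z, M x -> M y -> M z -> d x z <= d x y + d y z].

Definition compatible_metric (R : realType) (c : scalar_kind) (p : R)
    (A : int -> nat -> R)
    (d : (int -> scalar_field R c) -> (int -> scalar_field R c) -> R) : Prop :=
  let X := koethe_space (c := c) p A in
  [/\ metric_on X d,
      forall x y z, X x -> X y -> X z -> d (x + z) (y + z) = d x y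
    & forall x (U : set (int -> scalar_field R c)), X x ->
        (koethe_nbhs p A x U <->
         exists e : R, 0 < e /\ forall y, X y -> d x y < e -> U y)].

(* Li-Yorke chaos of a self-map g of the metric space (M, d), M being a subset
   of T.  The lower and upper limits are taken in the extended reals. *)
Definition li_yorke_chaotic (R : realType) (T : Type) (M : set T)
    (d : T -> T -> R) (g : T -> T) : Prop :=
  exists S : set T, [/\ S `<=` M, ~ countable S &
    forall x y, S x -> S y -> x <> y ->
      limn_einf (fun n => (d (iter n g x) (iter n g y))%:E) = 0%E /\
      (0 < limn_esup (fun n => (d (iter n g x) (iter n g y))%:E))%E].

Definition weighted_shift (F : numFieldType) (w : int -> F) (x : int -> F) :
    int -> F :=
  fun n => w n * x (n + 1).

(* w_i ... w_j, meaningful for i <= j only. *)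
Definition weight_prod (F : numFieldType) (w : int -> F) (i j : int) : F :=
  \prod_(m < `|j - i|%N.+1) w (i + m%:Z).

(* Main.v *)
(* If [x <> y] form a Li-Yorke pair, then [z = y - x] has an orbit that returns
   arbitrarily close to 0 without converging to 0.  A nonzero coordinate of [z]
   gives (a), and (b) must hold since otherwise the iterates would be
   equicontinuous.  Conversely the real multiples of one such [z] form an
   uncountable scrambled set, so it is enough to find [z].  If the orbit of the
   unit vector [e_0] does not tend to 0, then (a) lets us take [z = e_0].
   Otherwise the orbit of every unit vector tends to 0, and [z] is a lacunary
   sum of vectors [v_q e_(m_q)] with positive coefficients: the first [q]
   iterates of the [q]-th one are at most [2^-q] in the first [q] seminorms, but
   by (b) some later iterate exceeds 1 in a fixed seminorm.  The smallness uses
   the continuity of the shift, which a gliding hump derives from the fact that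
   the shift maps the space into itself.  As all coefficients are nonnegative,
   there is no cancellation, and l^1 bounds dominate the seminorms for all [p]. *)

Require Import Defs.
From mathcomp Require Import all_boot all_order all_algebra.
From mathcomp Require Import all_classical all_reals all_analysis.
From mathcomp Require Import complex zify ring lra.
Import Order.TTheory GRing.Theory Num.Theory.
Import numFieldTopology.Exports numFieldNormedType.Exports.
Local Open Scope classical_set_scope.
Local Open Scope ring_scope.

(** * Nonnegative sums and gliding humps *)

(** Bounding all finite partial sums keeps the estimates for nonnegative families inside [R];
    [esum_leP] links this to the extended-real sum. *)
Definition sums_le {R : realType} (f : int -> R) (e : R) : Prop :=
  forall s : seq int, uniq s -> \sum_(j <- s) f j <= e.

Lemma sum_geometric_tail (R : realType) (g : nat -> R) (t0 T : nat) :
  (forall t, 0 <= g t) ->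
  (forall t, (t0 <= t)%N -> g t <= 2^-1 ^+ t) ->
  \sum_(t < T) g t <= \sum_(t < t0) g t + 2 * 2^-1 ^+ t0.
Proof.
move=> g0 gle; have [Tt0|/subnKC <-] := leqP T t0.
  rewrite -[leLHS]addr0 lerD ?mulr_ge0 ?exprn_ge0 ?invr_ge0//.
  rewrite -(subnKC Tt0) big_split_ord/= lerDl.
  by apply: sumr_ge0 => i _; exact: g0.
set d := (T - t0.+1)%N; rewrite addSn -addnS; move: d.+1 => {T} d.
(* Subtracting the part of the geometric series still to come makes the induction on [d] close. *)
suff: \sum_(t < t0 + d) g t <=
    \sum_(t < t0) g t + 2 * 2^-1 ^+ t0 - 2 * 2^-1 ^+ (t0 + d).
  move=> /le_trans; apply; rewrite gerBl.
  by rewrite mulr_ge0 ?exprn_ge0 ?invr_ge0.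
elim: d => [|d IH]; first by rewrite addn0 addrK.
rewrite addnS big_ord_recr/= exprS.
have := gle (t0 + d)%N (leq_addr _ _); lra.
Qed.

(* When [m] is not injective, the first value is kept; it is the largest. *)
Lemma exists_sparse_values (R : realType) (m : nat -> int) (v : nat -> R) :
  (forall s t, (s <= t)%N -> m s = m t -> v t <= v s) ->
  exists z : int -> R, (forall t, v t <= z (m t)) /\
    (forall j, z j = 0 \/ exists2 t, m t = j & z j = v t).
Proof.
move=> vle; suff /choice[z zP] : forall j, exists y,
    (forall t, m t = j -> v t <= y) /\
    (y = 0 \/ exists2 t, m t = j & y = v t).
  by exists z; split => [t|j]; [apply: (proj1 (zP _))|exact: (proj2 (zP _))].
move=> j; have [[t0 /eqP mt0]|none] := pselect (exists t, m t = j).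
  have ex : exists t, m t == j by exists t0.
  case: (ex_minnP ex) => t /eqP mt tmin; exists (v t); split; last first.
    by right; exists t.
  by move=> u mu; apply: vle; [apply: tmin; apply/eqP|rewrite mt mu].
by exists 0; split; [move=> t mt; case: none; exists t|left].
Qed.

(** Each nonzero [z j] is one of the values [v t] with [m t = j]. After exchanging the two sums,
    every [t] is counted for at most one [j], so the bound on the sums over [t] carries over. *)
Lemma sums_le_sparse_values (R : realType) (m : nat -> int) (v : nat -> R)
    (z b : int -> R) (e : R) :
  (forall t, 0 <= v t) -> (forall j, 0 <= b j) ->
  (forall j, z j = 0 \/ exists2 t, m t = j & z j = v t) ->
  (forall T, \sum_(t < T) v t * b (m t) <= e) ->
  sums_le (fun j => z j * b j) e.
Proof.
move=> v0 b0 zP sume s us.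
pose h j t := if m t == j then v t * b (m t) else 0.
have h0 j t : 0 <= h j t by rewrite /h; case: ifP => // _; rewrite mulr_ge0.
have /choice[f fP] : forall j, exists t, z j * b j <= h j t.
  move=> j; case: (zP j) => [->|[t mt ->]]; first by exists 0%N; rewrite mul0r.
  by exists t; rewrite /h mt eqxx.
(* [T] exceeds every index [f j] selected for a [j] of the finite list. *)
pose T := (\max_(j <- s) f j).+1.
apply: le_trans (sume T).
rewrite (@le_trans _ _ (\sum_(j <- s) \sum_(t < T) h j t))//.
  rewrite big_seq [leRHS]big_seq; apply: ler_sum => j js.
  have fT : (f j < T)%N by rewrite ltnS; exact: leq_bigmax_seq.
  rewrite (bigD1 (Ordinal fT))//= (le_trans (fP j))// lerDl.
  by apply: sumr_ge0 => t _.
rewrite exchange_big/=; apply: ler_sum => t _.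
rewrite /h -big_mkcond/= big_const_seq iter_addr_0.
have -> : count (fun j => m t == j) s = (m t \in s).
  by rewrite -(count_uniq_mem _ us); apply: eq_count => j; rewrite /= eq_sym.
by case: (_ \in _) => //; rewrite mulr0n mulr_ge0.
Qed.

(** A gliding hump: hump [q] has size at most 2^-q at all levels up to [q], hence the humps are
    summable at each level, while [r] magnifies it to at least 2^q. *)
Lemma exists_unbounded_values (R : realType) (a : int -> nat -> R) (r : int -> R) :
  (forall m k, 0 < a m k) -> (forall m k l, (k <= l)%N -> a m k <= a m l) ->
  (forall l C, exists m, C * a m l < r m) ->
  exists z : int -> R, [/\ forall m, 0 <= z m,
    forall k, exists e, sums_le (fun m => z m * a m k) e &
    forall C, exists m, C < z m * r m].
Proof.
move=> a0 amono unb.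
(* One factor 2^q pays for summability, the other survives as growth. *)
have /choice[m mP] : forall q, exists m, 2 ^+ q * 2 ^+ q * a m q < r m.
  by move=> q; exact: unb.
pose v q := (2 ^+ q * a (m q) q)^-1.
have p2 q : 0 < 2 ^+ q :> R by rewrite exprn_gt0.
have v0 q : 0 < v q by rewrite invr_gt0 mulr_gt0.
have [|z [zge zP]] := exists_sparse_values _ m v.
  move=> s t st mst; rewrite /v lef_pV2 ?posrE ?mulr_gt0// mst.
  by rewrite ler_pM ?(ltW (a0 _ _)) ?(ltW (p2 _)) ?amono// ler_eXn2l// ltr1n.
exists z; split.
- by move=> j; case: (zP j) => [->//|[t _ ->]]; rewrite ltW.
- move=> k; exists (\sum_(t < k) v t * a (m t) k + 2 * 2^-1 ^+ k).
  apply: sums_le_sparse_values zP _ => [t|j|T]; [exact: ltW|exact: ltW|].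
  apply: (sum_geometric_tail _ (fun t => v t * a (m t) k)) => [t|t kt].
    by rewrite mulr_ge0 ?ltW.
  rewrite /v invfM exprVn -mulrA ger_pMr ?invr_gt0//.
  by rewrite mulrC ler_pdivrMr// mul1r amono.
- move=> C; pose q := (Num.truncn `|C|).+1; exists (m q).
  have Cq : C < 2 ^+ q.
    apply: (le_lt_trans (ler_norm C)); apply: (lt_trans (truncnS_gt _)).
    by rewrite -natrX ltr_nat ltn_expl.
  apply: (lt_le_trans Cq); apply: (@le_trans _ _ (v q * r (m q))).
    by rewrite /v mulrC ler_pdivlMr ?mulr_gt0// mulrA ltW.
  rewrite ler_wpM2r//; apply: le_trans (ltW (mP q)).
  by rewrite !mulr_ge0 ?ltW.
Qed.

(** Here [b m n k] stands for the level-[k] size of the [n]-th iterate of the unit vector at [m].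
    Bumps are added so sparsely that at suitable times the old ones have died out and the new ones
    have not yet grown, although each of them later reaches size 1 at level [k0]. *)
Lemma exists_semi_irregular_values (R : realType) (b : int -> nat -> nat -> R)
    (k0 : nat) :
  (forall m n k, 0 < b m n k) ->
  (forall m k e, 0 < e -> exists N, forall n, (N <= n)%N -> b m n k <= e) ->
  (forall q C, exists m n,
    C * (\sum_(i < q.+1) \sum_(k < q.+1) b m i k) < b m n k0) ->
  exists z : int -> R, [/\ forall m, 0 <= z m,
    forall k, exists e, sums_le (fun m => z m * b m 0 k) e,
    forall K N e, 0 < e -> exists2 n, (N <= n)%N &
      forall k, (k <= K)%N -> sums_le (fun m => z m * b m n k) e &
    forall N, exists n m, (N <= n)%N /\ 1 <= z m * b m n k0].
Proof.
move=> b0 bcvg unb.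
(* [D q m] dominates all sizes with time and level at most [q]; dividing by it makes bump [q] small
   throughout that range. *)
pose D q m := \sum_(i < q.+1) \sum_(k < q.+1) b m i k.
have p2 q : 0 < 2 ^+ q :> R by rewrite exprn_gt0.
have bD q m i k : (i <= q)%N -> (k <= q)%N -> b m i k <= D q m.
  move=> iq kq; rewrite /D (bigD1 (Ordinal (iq : (i < q.+1)%N)))//=.
  rewrite (bigD1 (Ordinal (kq : (k < q.+1)%N)))//= -addrA lerDl addr_ge0//.
    by apply: sumr_ge0 => ? _; exact: ltW.
  by apply: sumr_ge0 => ? _; apply: sumr_ge0 => ? _; exact: ltW.
have D0 q m : 0 < D q m by exact: lt_le_trans (b0 m 0 0) (bD q m 0 0 _ _).
have Dmono q q' m : (q <= q')%N -> D q m <= D q' m.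
  move=> qq'; have [d ->] : exists d, q' = (q + d)%N by exists (q' - q)%N; lia.
  rewrite /D -addSn big_split_ord/=.
  apply: ler_wpDr; first by do 2!apply: sumr_ge0 => ? _; exact: ltW.
  apply: ler_sum => i _; rewrite big_split_ord/= lerDl.
  by apply: sumr_ge0 => ? _; exact: ltW.
have /choice[mN mNP] : forall q, exists mn : int * nat,
    2 ^+ q * D q mn.1 < b mn.1 mn.2 k0.
  by move=> q; have [m [n mn]] := unb q (2 ^+ q); exists (m, n).
pose m q := (mN q).1; pose N q := (mN q).2.
pose v q := (2 ^+ q * D q (m q))^-1.
have v0 q : 0 < v q by rewrite invr_gt0 mulr_gt0.
have vN q : 1 <= v q * b (m q) (N q) k0.
  by rewrite /v mulrC ler_pdivlMr ?mulr_gt0// mul1r ltW// mNP.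
have vsmall q n k : (n <= q)%N -> (k <= q)%N -> v q * b (m q) n k <= 2^-1 ^+ q.
  move=> nq kq; rewrite /v invfM exprVn -mulrA ger_pMr ?invr_gt0//.
  by rewrite mulrC ler_pdivrMr// mul1r bD.
(* If [N q <= q], the large value would be one of the terms of [D q (m q)], which it exceeds. *)
have Nge q : (k0 <= q)%N -> (q < N q)%N.
  move=> kq; rewrite ltnNge; apply/negP => Nq.
  have := mNP q; apply/negP; rewrite -leNgt.
  apply: (le_trans (bD q (m q) (N q) k0 Nq kq)).
  by rewrite ler_peMl ?(ltW (D0 _ _))// exprn_ege1// ler1n.
(* Past the time [nxt q], the first [q + 1] bumps are negligible. *)
have /choice[nxt nxtP] : forall q, exists M, (q < M)%N /\
    forall q' k, (q' <= q)%N -> (k <= q)%N ->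
      v q' * b (m q') M k <= 2^-1 ^+ q / q.+1%:R.
  move=> q; pose e : R := 2^-1 ^+ q / q.+1%:R.
  have e0 : 0 < e by rewrite divr_gt0 ?exprn_gt0 ?invr_gt0 ?ltr0n.
  have /choice[f fP] : forall p : nat * nat, exists M, forall n, (M <= n)%N ->
      b (m p.1) n p.2 <= e / v p.1.
    by move=> p; apply: bcvg; rewrite divr_gt0.
  (* The sum of the finitely many thresholds is above each of them. *)
  exists (q + \sum_(i < q.+1) \sum_(k < q.+1) f (i : nat, k : nat)).+1.
  split=> [|q' k q'q kq]; first by rewrite ltnS leq_addr.
  rewrite mulrC -ler_pdivlMr//; apply: (fP (q', k)).
  rewrite (bigD1 (Ordinal (q'q : (q' < q.+1)%N)))//=.
  rewrite (bigD1 (Ordinal (kq : (k < q.+1)%N)))//=.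
  set x := f _; lia.
(* Only the bumps with index [Q t] are kept: each index lies past the time at which all earlier
   bumps have become negligible. *)
pose Q t := iter t nxt 0%N.
have Qlt t : (Q t < Q t.+1)%N by have [] := nxtP (Q t).
have Qge t : (t <= Q t)%N by elim: t => // t; have := Qlt t; lia.
have Qmono s t : (s <= t)%N -> (Q s <= Q t)%N.
  elim: t => [|t IH]; first by rewrite leqn0 => /eqP ->.
  by rewrite leq_eqVlt => /predU1P[->//|/IH]; have := Qlt t; lia.
have half t : 2^-1 ^+ Q t <= 2^-1 ^+ t :> R.
  by rewrite !exprVn lef_pV2 ?posrE// ler_weXn2l// ler1n.
have [|z [zge zP]] := exists_sparse_values _ (m \o Q) (v \o Q).
  move=> s t st /= mst; rewrite /v lef_pV2 ?posrE ?mulr_gt0// mst.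
  by rewrite ler_pM ?(ltW (D0 _ _)) ?(ltW (p2 _)) ?Dmono ?Qmono// ler_weXn2l ?ler1n ?Qmono.
have sums n k t0 : (n <= Q t0)%N -> (k <= Q t0)%N ->
    sums_le (fun j => z j * b j n k)
      (\sum_(t < t0) v (Q t) * b (m (Q t)) n k + 2 * 2^-1 ^+ t0).
  move=> nt kt; apply: sums_le_sparse_values zP _ => [t|j|T]; [exact: ltW (v0 _)|exact: ltW|].
  apply: (sum_geometric_tail _ (fun t => v (Q t) * b (m (Q t)) n k)) => [t|t tt].
    by rewrite mulr_ge0 ?ltW.
  apply: le_trans (half t); apply: vsmall;
    by [apply: leq_trans nt _; exact: Qmono|apply: leq_trans kt _; exact: Qmono].
exists z; split.
- by move=> j; case: (zP j) => [->//|[t _ ->]]; exact: ltW (v0 _).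
- by move=> k; eexists; apply: (sums 0 k k).
- move=> K N0 e e0.
  (* At time [Q t.+1] the bumps 0 to [t] contribute at most 2^-t by [nxtP], and the later ones at
     most 2 * 2^-(t+1). This [t] makes the total 2 * 2^-t at most [e]. *)
  pose t := (N0 + K + Num.truncn (2 / e)).+1.
  have ht : 2 * 2^-1 ^+ t <= e.
    rewrite exprVn -[_ * _]/(2 / _) ler_pdivrMr// mulrC -ler_pdivrMr//.
    apply: (le_trans (ltW (truncnS_gt _))); rewrite -natrX ler_nat.
    apply: leq_trans (ltnW (ltn_expl t (ltnSn 1))).
    by rewrite ltnS leq_addl.
  have Qt := Qlt t; have tQ := Qge t.
  exists (Q t.+1) => [|k kK]; first by rewrite /t in Qt tQ *; lia.
  have kQ : (k <= Q t)%N by rewrite /t in Qt tQ *; lia.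
  move=> s us; apply: le_trans (sums (Q t.+1) k t.+1 _ _ s us) _ => //.
    exact: leq_trans kQ (ltnW Qt).
  have : \sum_(i < t.+1) v (Q i) * b (m (Q i)) (Q t.+1) k <= 2^-1 ^+ t.
    apply: (@le_trans _ _ (\sum_(i < t.+1) 2^-1 ^+ Q t / (Q t).+1%:R)).
      apply: ler_sum => i _; have [_] := nxtP (Q t); apply => //.
      by apply: Qmono; rewrite -ltnS.
    (* There are [t + 1] equal terms and [t <= Q t], so the divisor [Q t + 1] absorbs their
       number. *)
    rewrite sumr_const card_ord -[_ *+ t.+1]mulr_natr -mulrA.
    apply: le_trans (half t); rewrite ger_pMr ?exprn_gt0 ?invr_gt0//.
    by rewrite mulrC ler_pdivrMr// mul1r ler_nat.
  have h2 : 2 * 2^-1 ^+ t.+1 = 2^-1 ^+ t :> R by rewrite exprS mulrA divff ?mul1r.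
  by lra.
- move=> N0; pose t := (N0 + k0)%N; exists (N (Q t)), (m (Q t)).
  have tQ := Qge t; split; first by have := Nge (Q t); rewrite /t in tQ *; lia.
  by apply: le_trans (vN (Q t)) _; rewrite ler_wpM2r ?(ltW (b0 _ _ _))//; exact: zge.
Qed.

(** * Köthe sequence spaces *)

Section Modulus.
Context {R : realType} {c : scalar_kind}.
Implicit Types x y : scalar_field R c.

Lemma modulus_ge0 x : 0 <= modulus x.
Proof. by case: c x => [x|[a b]] /=; rewrite ?normr_ge0 ?sqrtr_ge0. Qed.

Lemma modulusM x y : modulus (x * y) = modulus x * modulus y.
Proof. by case: c x y => x y /=; [exact: normrM|exact: ComplexField.Normc.normcM]. Qed.

Lemma modulusN x : modulus (- x) = modulus x.
Proof. by case: c x => x /=; [exact: normrN|exact: normcN]. Qed.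

Lemma ler_modulusD x y : modulus (x + y) <= modulus x + modulus y.
Proof. by case: c x y => x y /=; [exact: ler_normD|exact: le_normcD]. Qed.

Lemma modulus_of_real (a : R) : modulus (of_real c a) = `|a|.
Proof. by case: c => //=; rewrite expr0n/= addr0 sqrtr_sqr. Qed.

Lemma of_realB (a b : R) : of_real c (a - b) = of_real c a - of_real c b.
Proof. by case: c => //=; rewrite rmorphB. Qed.

Lemma modulus1 : modulus (1 : scalar_field R c) = 1.
Proof.
have -> : 1 = of_real c (1 : R) by case: c.
by rewrite modulus_of_real normr1.
Qed.

Lemma modulus0 : modulus (0 : scalar_field R c) = 0.
Proof.
have -> : 0 = of_real c (0 : R) by case: c.
by rewrite modulus_of_real normr0.
Qed.

Lemma modulus_eq0 x : modulus x = 0 -> x = 0.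
Proof.
case: c x => x /=; last exact: ComplexField.Normc.eq0_normc.
by move=> /eqP; rewrite normr_eq0 => /eqP.
Qed.

Lemma modulus_gt0 x : x <> 0 -> 0 < modulus x.
Proof.
by move=> x0; rewrite lt_def modulus_ge0 andbT; apply/eqP => /modulus_eq0.
Qed.

Lemma modulus_prod (I : Type) (s : seq I) (f : I -> scalar_field R c) :
  modulus (\prod_(i <- s) f i) = \prod_(i <- s) modulus (f i).
Proof. exact: (big_morph _ modulusM modulus1). Qed.

End Modulus.

(** * Sums of real families indexed by the integers *)

Section Sums.
Context {R : realType}.
Implicit Types (f g : int -> R) (e : R).

Lemma esum_leP f e : (forall j, 0 <= f j) ->
  (\esum_(j in [set: int]) (f j)%:E <= e%:E)%E <-> sums_le f e.
Proof.
move=> f0; split => [fe s us|fe].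
  rewrite -lee_fin; apply: le_trans fe; apply: esum_ge.
  exists [set` s]; first by split => //; exact: finite_seq.
  by rewrite -sumEFin -fsbig_seq.
rewrite /esum; apply: ge_ereal_sup => _ [F [finF _] <-].
by rewrite fsbig_finite// sumEFin lee_fin; apply: fe; exact: finmap.fset_uniq.
Qed.

Lemma esum_ltyP f : (forall j, 0 <= f j) ->
  (\esum_(j in [set: int]) (f j)%:E < +oo)%E <-> exists e, sums_le f e.
Proof.
move=> f0; split => [foo|[e /esum_leP fe]]; last first.
  by apply: le_lt_trans (fe f0) _; rewrite ltry.
exists (fine (\esum_(j in [set: int]) (f j)%:E)%E); apply/esum_leP => //.
by rewrite fineK// ge0_fin_numE//; apply: esum_ge0 => j _; rewrite lee_fin.
Qed.

Lemma sums_le_single f e j : sums_le f e -> f j <= e.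
Proof. by move=> /(_ [:: j] isT); rewrite big_seq1. Qed.

(** A translation sends distinct indices to distinct indices. The case [n = 0] serves for termwise
    comparison. *)
Lemma sums_le_shift f g e (C : R) (n : int) : 0 <= C ->
  (forall j, f j <= C * g (j + n)) -> sums_le g e -> sums_le f (C * e).
Proof.
move=> C0 fg ge s us.
apply: (@le_trans _ _ (\sum_(j <- s) C * g (j + n))); first exact: ler_sum.
rewrite -mulr_sumr ler_wpM2l// -(big_map (fun j => j + n) predT).
by apply: ge; rewrite map_inj_uniq//; exact: addIr.
Qed.

Lemma sums_le_delta f (i : int) : 0 <= f i ->
  sums_le (fun j => (j == i)%:R * f j) (f i).
Proof.
move=> fi0 s us; have z j : j != i -> (j == i)%:R * f j = 0.
  by move=> /negPf ->; rewrite mul0r.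
have [si|si] := boolP (i \in s).
  by rewrite (bigD1_seq i)//= big1 ?addr0 ?eqxx ?mul1r// => j; exact: z.
rewrite big1_seq// => j /andP[_ js]; apply: z.
by apply: contraNneq si => <-.
Qed.

(** Otherwise indices with [f j >= r] could be collected without end, and the partial sums would
    exceed [e]. *)
Lemma sums_le_vanish f e (r : R) : (forall j, 0 <= f j) -> sums_le f e -> 0 < r ->
  exists N, forall j : int, (N <= `|j|)%N -> f j < r.
Proof.
move=> f0 fe r0; apply: contrapT => /forallNP none.
have big n : exists s, [/\ uniq s & n%:R * r <= \sum_(j <- s) f j].
  elim: n => [|n [s [us sn]]]; first by exists [::]; rewrite mul0r big_nil.
  (* Any index of absolute value at least [N] is new to [s]. *)
  pose N := (\max_(j <- s) `|j|%N).+1.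
  have /existsNP[j /not_implyP[Nj /negP]] := none N; rewrite -leNgt => rj.
  exists (j :: s); rewrite big_cons /= us andbT; split; last first.
    by rewrite -natr1 mulrDl mul1r addrC lerD.
  apply/negP => js; move: Nj; rewrite leqNgt ltnS => /negP; apply.
  exact: leq_bigmax_seq.
have [s [us]] := big (Num.truncn (e / r)).+1; apply/negP; rewrite -ltNge.
apply: (le_lt_trans (fe s us)); rewrite -ltr_pdivrMr//; exact: truncnS_gt.
Qed.

End Sums.

Section KoetheSpaceTheory.
Context {R : realType} {c : scalar_kind} {p : R} {A : int -> nat -> R}.
Hypotheses (hp : p = 0 \/ 1 <= p) (A0 : forall j k, 0 < A j k).
Hypothesis Amono : forall j k l, (k <= l)%N -> A j k <= A j l.
Local Notation K := (scalar_field R c).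
Implicit Types (x y : int -> K) (k l : nat) (e C : R).

(* [level_le k x e] expresses [koethe_seminorm p A k x <= e] without roots. *)
Definition level_le k x e : Prop :=
  if p == 0 then forall j, weighted_abs A k x j <= e
  else sums_le (fun j => weighted_abs A k x j `^ p) (e `^ p).

Lemma weighted_absE k x j : weighted_abs A k x j = A j k * modulus (x j).
Proof. by rewrite /weighted_abs modulusM modulus_of_real gtr0_norm. Qed.

Lemma weighted_abs_ge0 k x j : 0 <= weighted_abs A k x j.
Proof. exact: modulus_ge0. Qed.

Lemma exponent_ge1 : p != 0 -> 1 <= p.
Proof. by case: hp => [->|//]; rewrite eqxx. Qed.

Lemma exponent_gt0 : p != 0 -> 0 < p.
Proof. by move=> /exponent_ge1; exact: lt_le_trans. Qed.

Lemma koethe_seminorm_leP k x e : 0 <= e ->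
  (koethe_seminorm p A k x <= e%:E)%E <-> level_le k x e.
Proof.
move=> e0; rewrite /koethe_seminorm /level_le; case: ifPn => [_|p0].
  split => [xe j|xe].
    by rewrite -lee_fin; apply: le_trans xe; apply: ereal_sup_ubound; exists j.
  by apply: ge_ereal_sup => _ [j _ <-]; rewrite lee_fin.
have p1 := exponent_gt0 p0.
rewrite -esum_leP => [|j]; last exact: powR_ge0.
set S := (\esum_(_ in _) _)%E.
have S0 : (0 <= S)%E by apply: esum_ge0 => j _; rewrite lee_fin powR_ge0.
rewrite -poweR_EFin; split => h.
  have -> : S = ((S `^ p^-1) `^ p)%E by rewrite -poweRrM mulVf// poweRe1.
  by apply: (gt0_ler_poweR (ltW p1)) => //; rewrite in_itv/= leey andbT ?poweR_ge0 ?lee_fin.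
have -> : e%:E = ((e%:E `^ p) `^ p^-1)%E by rewrite -poweRrM mulfV// poweRe1.
have pi0 : 0 <= p^-1 by rewrite invr_ge0 ltW.
apply: (gt0_ler_poweR pi0) => //; rewrite in_itv/= leey andbT//.
by rewrite lee_fin powR_ge0.
Qed.

Lemma koethe_spaceP x : koethe_space p A x <-> forall k,
  if p == 0 then forall e, 0 < e ->
     exists N : nat, forall j : int, (N <= `|j|)%N -> weighted_abs A k x j < e
  else exists e, sums_le (fun j => weighted_abs A k x j `^ p) e.
Proof.
rewrite /koethe_space/=; split=> xX k; move: (xX k); case: ifP => // _;
  by move/esum_ltyP; apply=> j; exact: powR_ge0.
Qed.

Lemma level_le_coord k x e j : 0 <= e -> level_le k x e ->
  weighted_abs A k x j <= e.
Proof.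
move=> e0; rewrite /level_le; case: ifPn => [_ //|p0 /(sums_le_single _ _ j)].
rewrite leNgt => xe; rewrite leNgt; apply: contra xe => ex.
by apply: gt0_ltr_powR => //; [exact: exponent_gt0|rewrite nnegrE weighted_abs_ge0].
Qed.

(** This covers every [p] at once; monotonicity in the level, scaling and the equicontinuity of the
    iterates are all instances. *)
Lemma level_le_shift k l x y e C (n : int) : 0 <= C -> 0 <= e ->
  (forall j, weighted_abs A k y j <= C * weighted_abs A l x (j + n)) ->
  level_le l x e -> level_le k y (C * e).
Proof.
move=> C0 e0 yx; rewrite /level_le; case: ifPn => [_ xe j|p0].
  by apply: le_trans (yx j) _; rewrite ler_wpM2l.
rewrite powRM//; apply: (sums_le_shift _ _ _ _ n); first exact: powR_ge0.
move=> j; rewrite -powRM ?weighted_abs_ge0//.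
apply: ge0_ler_powR; rewrite ?nnegrE ?weighted_abs_ge0 ?mulr_ge0 ?weighted_abs_ge0//.
exact/ltW/exponent_gt0.
Qed.

Lemma level_le_mono k l x e : (k <= l)%N -> 0 <= e ->
  level_le l x e -> level_le k x e.
Proof.
move=> kl e0 xe; rewrite -[e]mul1r; apply: (level_le_shift _ l x _ _ _ 0) => //.
move=> j; rewrite mul1r addr0 !weighted_absE ler_wpM2r ?modulus_ge0//.
exact: Amono.
Qed.

Lemma level_le_scale k x e (a : K) : 0 <= e -> level_le k x e ->
  level_le k (fun j => a * x j) (modulus a * e).
Proof.
move=> e0; apply: (level_le_shift _ k _ _ _ _ 0) => //; first exact: modulus_ge0.
by move=> j; rewrite addr0 !weighted_absE modulusM mulrCA.
Qed.

(* As no term exceeds [e], each [p]-th power is at most [e `^ (p - 1)] times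
   the term itself. *)
Lemma level_le_sums k x e : 0 < e -> sums_le (weighted_abs A k x) e ->
  level_le k x e.
Proof.
move=> e0 xe; rewrite /level_le; case: ifPn => [_ j|p0].
  exact: (sums_le_single _ _ j xe).
have p1 := exponent_gt0 p0.
rewrite -(mulr_powRB1 (ltW e0) p1) mulrC.
apply: (sums_le_shift _ _ _ _ 0 _ _ xe); first exact: powR_ge0.
move=> j; rewrite addr0 -(mulr_powRB1 (weighted_abs_ge0 _ _ _) p1) mulrC.
rewrite ler_wpM2r ?weighted_abs_ge0//.
apply: ge0_ler_powR; rewrite ?nnegrE ?subr_ge0 ?weighted_abs_ge0 ?(ltW e0)//.
  exact: exponent_ge1.
exact: (sums_le_single _ _ j xe).
Qed.

Lemma koethe_space_sums x :
  (forall k, exists e, sums_le (weighted_abs A k x) e) -> koethe_space p A x.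
Proof.
move=> xe; apply/koethe_spaceP => k; have {xe} [e xe] := xe k.
have := @level_le_sums k x (`|e| + 1); rewrite /level_le; case: ifPn => [_ _|p0 h].
  by move=> r; apply: sums_le_vanish xe => j; exact: weighted_abs_ge0.
eexists; apply: h; first by rewrite ltr_wpDl.
by move=> s us; apply: le_trans (xe s us) _; rewrite ler_wpDr// ler_norm.
Qed.

Lemma koethe_space_bounded x k : koethe_space p A x ->
  exists e, forall j, weighted_abs A k x j <= e.
Proof.
move/koethe_spaceP/(_ k); case: ifPn => [_ /(_ 1 ltr01)[N xN]|p0 [e xe]].
  (* The entries outside the window are below 1; those inside are bounded by the sum over both signs
     of the index. *)
  exists (1 + \sum_(i < N) (weighted_abs A k x i%:Z + weighted_abs A k x (- i%:Z))).
  move=> j; have [Nj|jN] := leqP N `|j|%N.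
    apply: (le_trans (ltW (xN _ Nj))); rewrite lerDl.
    by apply: sumr_ge0 => i _; rewrite addr_ge0 ?weighted_abs_ge0.
  rewrite (bigD1 (Ordinal jN))//= addrCA; apply: ler_wpDr.
    rewrite addr_ge0//; apply: sumr_ge0 => i _.
    by rewrite addr_ge0 ?weighted_abs_ge0.
  have [j0|j0] := leP 0 j.
    by rewrite gez0_abs// lerDl weighted_abs_ge0.
  by rewrite lez0_abs ?(ltW j0)// opprK lerDr weighted_abs_ge0.
have e0 : 0 <= e by apply: le_trans (sums_le_single _ _ 0 xe); exact: powR_ge0.
have p1 := exponent_gt0 p0.
exists (e `^ p^-1) => j; rewrite leNgt; apply/negP => ej.
have := sums_le_single _ _ j xe; apply/negP; rewrite -ltNge.
have -> : e = (e `^ p^-1) `^ p by rewrite -powRrM mulVf// powRr1.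
by apply: gt0_ltr_powR => //; rewrite nnegrE ?powR_ge0 ?weighted_abs_ge0.
Qed.

Lemma koethe_space_scale x (a : K) : koethe_space p A x ->
  koethe_space p A (fun j => a * x j).
Proof.
have wE k j : weighted_abs A k (fun j => a * x j) j =
    modulus a * weighted_abs A k x j by rewrite !weighted_absE modulusM mulrCA.
move=> /koethe_spaceP xX; apply/koethe_spaceP => k; move: (xX k).
case: ifPn => [_ xe e e0|p0 [e xe]].
  (* Adding 1 keeps the divisor positive when [a = 0]. *)
  have a1 : 0 < modulus a + 1 by rewrite ltr_wpDl ?modulus_ge0.
  have [N xN] := xe (e / (modulus a + 1)) (divr_gt0 e0 a1).
  exists N => j /xN; rewrite ltr_pdivlMr// wE => h; apply: le_lt_trans h.
  by rewrite mulrC ler_wpM2l ?weighted_abs_ge0// lerDl.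
exists (modulus a `^ p * e); apply: (sums_le_shift _ _ _ _ 0 _ _ xe).
  exact: powR_ge0.
by move=> j; rewrite addr0 wE powRM ?modulus_ge0 ?weighted_abs_ge0.
Qed.

Lemma koethe_spaceB x y : koethe_space p A x -> koethe_space p A y ->
  koethe_space p A (x - y).
Proof.
have wle k j : weighted_abs A k (x - y) j <=
    weighted_abs A k x j + weighted_abs A k y j.
  rewrite !weighted_absE -mulrDr ler_wpM2l ?(ltW (A0 _ _))//.
  by apply: le_trans (ler_modulusD _ _) _; rewrite modulusN.
move=> /koethe_spaceP xX /koethe_spaceP yX; apply/koethe_spaceP => k.
move: (xX k) (yX k); case: ifPn => [_ xe ye e e0|p0 [e xe] [e' ye]].
  have e2 : 0 < e / 2 by rewrite divr_gt0.
  have [N xN] := xe _ e2; have [M yM] := ye _ e2.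
  exists (N + M)%N => j NMj.
  have Nj : (N <= `|j|)%N by lia.
  have Mj : (M <= `|j|)%N by lia.
  have := wle k j; have := xN j Nj; have := yM j Mj; lra.
have p1 := exponent_gt0 p0.
(* The estimate (u + v)^p <= (2 max(u, v))^p <= 2^p (u^p + v^p) takes the place of Minkowski's
   inequality. *)
exists (2 `^ p * (e + e')) => s us.
apply: (@le_trans _ _ (\sum_(j <- s) 2 `^ p *
    (weighted_abs A k x j `^ p + weighted_abs A k y j `^ p))).
  apply: ler_sum => j _; have := wle k j.
  set u := weighted_abs A k x j; set v := weighted_abs A k y j.
  have u0 : 0 <= u by exact: weighted_abs_ge0.
  have v0 : 0 <= v by exact: weighted_abs_ge0.
  move=> uv; apply: (@le_trans _ _ ((2 * Num.max u v) `^ p)).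
    apply: ge0_ler_powR; rewrite ?nnegrE ?weighted_abs_ge0 ?(ltW p1)//.
      by rewrite mulr_ge0// le_max u0.
    by apply: le_trans uv _; rewrite mulr_natl mulr2n lerD// le_max lexx ?orbT.
  rewrite powRM ?le_max ?u0// ler_wpM2l ?powR_ge0//.
  by rewrite /Num.max; case: ifP => _; rewrite ?lerDl ?lerDr powR_ge0.
rewrite -mulr_sumr ler_wpM2l ?powR_ge0// big_split/= lerD//.
  exact: xe.
exact: ye.
Qed.

Lemma koethe_space0 : koethe_space p A (0 : int -> K).
Proof.
apply: koethe_space_sums => k; exists 0 => s _; rewrite big1// => j _.
by rewrite weighted_absE modulus0 mulr0.
Qed.

End KoetheSpaceTheory.

(** * Orbits of the weighted shift *)

Section ShiftOrbits.
Context {R : realType} {c : scalar_kind} {p : R} {A : int -> nat -> R}.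
Context {w : int -> scalar_field R c}.
Local Notation K := (scalar_field R c).
Local Notation B := (weighted_shift w).
Local Notation level_le := (@level_le R c p A).
Implicit Types (x y : int -> K) (k l n : nat) (m : int) (e C : R).

(* The [k]-th seminorm of the [n]-th iterate of the unit vector at [m]. *)
Definition orbit_weight m n k : R :=
  A (m - n%:Z) k * \prod_(r < n) modulus (w (m - n%:Z + r%:Z)).

Lemma iter_weighted_shiftE n x j :
  iter n B x j = (\prod_(r < n) w (j + r%:Z)) * x (j + n%:Z).
Proof.
elim: n j => [|n IH] j; first by rewrite big_ord0 mul1r addr0.
rewrite iterS /weighted_shift IH big_ord_recl/= addr0 mulrA; congr (_ * _ * _).
  by apply: eq_bigr => r _; rewrite -addrA.
by congr x; lia.
Qed.

Hypothesis A0 : forall j k, 0 < A j k.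

Lemma weighted_abs_iter k n x j : weighted_abs A k (iter n B x) j =
  orbit_weight (j + n%:Z) n k * modulus (x (j + n%:Z)).
Proof.
by rewrite weighted_absE// iter_weighted_shiftE modulusM modulus_prod mulrA
  /orbit_weight addrK.
Qed.

Hypothesis w0 : forall m, w m <> 0.

Lemma orbit_weight_gt0 m n k : 0 < orbit_weight m n k.
Proof. by rewrite mulr_gt0// prodr_gt0// => r _; exact: modulus_gt0. Qed.

Lemma orbit_weight0 m k : orbit_weight m 0 k = A m k.
Proof. by rewrite /orbit_weight big_ord0 mulr1 subr0. Qed.

(** After [n] steps the unit vector at [m] has become a multiple of the one at [m - n], with [n']
    steps left. *)
Lemma orbit_weightD m n n' k : orbit_weight m (n + n') k =
  orbit_weight (m - n%:Z) n' k * \prod_(r < n) modulus (w (m - n%:Z + r%:Z)).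
Proof.
rewrite /orbit_weight addnC PoszD opprD addrA big_split_ord/= mulrA.
rewrite [m - n'%:Z - _]addrAC; congr (_ * _ * _); apply: eq_bigr => r _.
by congr (modulus (w _)); lia.
Qed.

Hypothesis Amono : forall j k l, (k <= l)%N -> A j k <= A j l.

Lemma orbit_weight_mono m n k l : (k <= l)%N ->
  orbit_weight m n k <= orbit_weight m n l.
Proof.
move=> kl; rewrite ler_wpM2r ?Amono// prodr_ge0// => r _; exact: modulus_ge0.
Qed.

Lemma orbit_weight_weight_prod i j k : i <= j ->
  A i k * modulus (weight_prod w i j) = orbit_weight (j + 1) `|j - i|%N.+1 k.
Proof.
move=> ij; rewrite /orbit_weight /weight_prod modulus_prod.
by have -> : j + 1 - `|j - i|%N.+1%:Z = i by lia.
Qed.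

(** The orbit of the unit vector with the larger index runs through multiples of the other one, so
    the two differ by a time delay and a constant factor. *)
Lemma orbit_weight_comparable m m' : exists C s s', 0 < C /\
  forall n k, orbit_weight m' (n + s') k = C * orbit_weight m (n + s) k.
Proof.
pose g m n := \prod_(r < n) modulus (w (m - n%:Z + r%:Z)).
have g0 m0 n : 0 < g m0 n by rewrite prodr_gt0// => r _; exact: modulus_gt0.
have [mm'|mm'] := leP m m'.
  exists (g m' `|m' - m|%N), 0%N, `|m' - m|%N; split=> // n k.
  rewrite addn0 addnC orbit_weightD mulrC; congr (_ * orbit_weight _ _ _); lia.
exists (g m `|m - m'|%N)^-1, `|m - m'|%N, 0%N; split=> [|n k].
  by rewrite invr_gt0.
rewrite addn0 [(_ + `|_|)%N]addnC orbit_weightD -/(g _ _) [X in _ * X]mulrC mulKf ?gt_eqF//.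
congr (orbit_weight _ _ _); lia.
Qed.

Lemma orbit_weight_frequently m m' :
  (forall k N e, 0 < e -> exists2 n, (N <= n)%N & orbit_weight m n k <= e) ->
  forall k N e, 0 < e -> exists2 n, (N <= n)%N & orbit_weight m' n k <= e.
Proof.
have [C [s [s' [C0 mm']]]] := orbit_weight_comparable m m'.
move=> h k N e e0; have [n Nn ne] := h k (N + s)%N (e / C) (divr_gt0 e0 C0).
exists (n - s + s')%N; first by lia.
by rewrite mm' subnK ?(leq_trans _ Nn) ?leq_addl// mulrC -ler_pdivlMr.
Qed.

Lemma orbit_weight_eventually m m' k :
  (forall e, 0 < e -> exists N, forall n, (N <= n)%N -> orbit_weight m n k <= e) ->
  forall e, 0 < e -> exists N, forall n, (N <= n)%N -> orbit_weight m' n k <= e.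
Proof.
have [C [s [s' [C0 mm']]]] := orbit_weight_comparable m m'.
move=> h e e0; have [N Ne] := h (e / C) (divr_gt0 e0 C0).
exists (N + s')%N => n Nn; have -> : n = (n - s' + s')%N by lia.
by rewrite mm' mulrC -ler_pdivlMr//; apply: Ne; lia.
Qed.

Lemma condition_aP :
  (exists n : nat -> nat,
      [/\ forall i, (0 < n i)%N, forall i, (n i < n i.+1)%N
        & forall k : nat, (fun i : nat =>
            modulus (of_real c (A (- (n i)%:Z) k)
                     * weight_prod w (- (n i)%:Z) (-1))) @ \oo --> (0 : R)]) <->
  (forall k N e, 0 < e -> exists2 n, (N <= n)%N & orbit_weight 0 n k <= e).
Proof.
have wE n k : (0 < n)%N ->
    modulus (of_real c (A (- n%:Z) k) * weight_prod w (- n%:Z) (-1)) =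
    orbit_weight 0 n k.
  move=> n0; rewrite modulusM modulus_of_real gtr0_norm//.
  by rewrite orbit_weight_weight_prod; [congr (orbit_weight _ _ _); lia|lia].
split=> [[n [n0 nS ncvg]] k N e e0|h].
  have nge i : (i <= n i)%N by elim: i => // i; have := nS i; lia.
  have /cvgrPdist_le/(_ e e0)[M _ Me] := ncvg k.
  exists (n (N + M)%N); first by apply: leq_trans (nge _); exact: leq_addr.
  have := Me (N + M)%N (leq_addl _ _).
  by rewrite /= sub0r normrN wE// ger0_norm// ltW// orbit_weight_gt0.
have /choice[g gP] : forall q : nat * nat, exists n, (q.2 <= n)%N /\
    orbit_weight 0 n q.1 <= q.1.+1%:R^-1.
  move=> q; have q0 : 0 < q.1.+1%:R^-1 :> R by rewrite invr_gt0.
  by have [n qn nq] := h q.1 q.2 _ q0; exists n.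
(* Diagonal choice: [n i] lies beyond its predecessor and makes the level-[i] weight at most
   1/(i+1), which bounds all lower levels too. Starting from 1 keeps [n 0] positive. *)
pose n := fix n i := if i is i'.+1 then g (i, (n i').+1) else g (0, 1)%N.
have nS i : (n i < n i.+1)%N by have [] := gP (i.+1, (n i).+1).
have n0 i : (0 < n i)%N.
  by case: i => [|i]; [have [] := gP (0, 1)%N|exact: leq_ltn_trans (nS i)].
exists n; split=> // k; apply/cvgrPdist_le => e e0.
exists (k + Num.truncn e^-1)%N => // i /= ki.
rewrite sub0r normrN wE// ger0_norm ?(ltW (orbit_weight_gt0 _ _ _))//.
apply: (@le_trans _ _ (orbit_weight 0 (n i) i)).
  by apply: orbit_weight_mono; apply: leq_trans ki; exact: leq_addr.
have /le_trans : orbit_weight 0 (n i) i <= i.+1%:R^-1.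
  by case: i {ki} => [|i]; [have [] := gP (0, 1)%N|have [] := gP (i.+1, (n i).+1)].
apply; rewrite invf_ple ?posrE//.
apply: (le_trans (ltW (truncnS_gt _))); rewrite ler_nat ltnS.
by apply: leq_trans ki; exact: leq_addl.
Qed.

(** The substitution is [m = j + 1] and [n = j - i + 1]. *)
Lemma condition_bP k l :
  ereal_sup [set r : \bar R | exists i j : int, i <= j /\
     r = (A i k * modulus (weight_prod w i j) / A (j + 1) l)%:E] = +oo%E <->
  forall C, exists m n, (0 < n)%N /\ C * A m l < orbit_weight m n k.
Proof.
split=> [supoo C|h].
  have := ltry C; rewrite -supoo.
  move=> /ereal_sup_gt[_ [i [j [ij ->]]]]; rewrite lte_fin ltr_pdivlMr//.
  rewrite orbit_weight_weight_prod// => lt.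
  by exists (j + 1), `|j - i|%N.+1.
apply/eqyP => C C0; have [m [n [n0 /ltW mn]]] := h C.
apply: le_ereal_sup_tmp.
exists (A (m - n%:Z) k * modulus (weight_prod w (m - n%:Z) (m - 1)) / A m l)%:E.
  by exists (m - n%:Z), (m - 1); split; [lia|rewrite subrK].
rewrite lee_fin ler_pdivlMr// orbit_weight_weight_prod; last lia.
by rewrite subrK; have -> : `|(m - 1 - (m - n%:Z))%R|%N.+1 = n by lia.
Qed.

Hypothesis hp : p = 0 \/ 1 <= p.

(** As the seminorms increase with the level, treating one level at a time captures closeness to 0
    in the metric. *)
Definition frequently_small x : Prop := forall k N e, 0 < e ->
  exists2 n, (N <= n)%N & level_le k (iter n B x) e.

Definition frequently_large x : Prop := exists k e, 0 < e /\
  forall N, exists2 n, (N <= n)%N & ~ level_le k (iter n B x) e.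

Lemma iter_weighted_shift_koethe_space x :
  (forall x, koethe_space p A x -> koethe_space p A (B x)) ->
  koethe_space p A x -> forall n, koethe_space p A (iter n B x).
Proof. by move=> hB xX; elim=> //= n; exact: hB. Qed.

Lemma frequently_large_neq0 x : frequently_large x -> exists m, x m <> 0.
Proof.
move=> [k [e [e0 large]]]; apply: contrapT => /forallNP x0.
have [n _] := large 0%N; apply; apply: (level_le_sums hp) => // s us.
rewrite big1 ?ltW// => j _; rewrite weighted_abs_iter.
by move: (x0 (j + n%:Z)) => /contrapT ->; rewrite modulus0 mulr0.
Qed.

(** A nonzero coordinate [x m] sits at position [m - n] after [n] steps, scaled by the orbit weight
    of [m]; smallness then passes from [m] to 0. *)
Lemma orbit_weight_frequently_small x : frequently_small x -> frequently_large x ->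
  forall k N e, 0 < e -> exists2 n, (N <= n)%N & orbit_weight 0 n k <= e.
Proof.
move=> small /frequently_large_neq0[m xm].
apply: (orbit_weight_frequently m) => k N e egt.
have [n Nn xn] := small k N (e * modulus (x m)) (mulr_gt0 egt (modulus_gt0 _ xm)).
exists n => //; have := level_le_coord hp _ _ _ (m - n%:Z) _ xn.
rewrite weighted_abs_iter subrK ler_pM2r ?modulus_gt0//; apply.
by rewrite mulr_ge0 ?modulus_ge0 ?ltW.
Qed.

(* Otherwise the iterates are equicontinuous, and an orbit that comes close to 0
   once stays close to 0. *)
Lemma orbit_weight_unbounded x : frequently_small x -> frequently_large x ->
  exists k, forall l C, exists m n, (0 < n)%N /\ C * A m l < orbit_weight m n k.
Proof.
move=> small [k [e [e0 large]]]; exists k => l C; apply: contrapT => none.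
have C1 : 0 < `|C| + 1 by rewrite ltr_wpDl.
have bound m n : (0 < n)%N -> orbit_weight m n k <= (`|C| + 1) * A m l.
  move=> n0; rewrite leNgt; apply/negP => lt; apply: none; exists m, n; split=> //.
  by apply: le_lt_trans lt; rewrite ler_wpM2r ?(ltW (A0 _ _))// ler_wpDr// ler_norm.
(* At time [n1] the orbit is so small at level [l] that the uniform bound keeps it below [e] at
   level [k] ever after. *)
have [n1 _ small1] := small l 0%N _ (divr_gt0 e0 C1).
have [n n1n] := large n1.+1; apply.
have -> : n = (n - n1 + n1)%N by lia.
rewrite iterD.
have -> : e = (`|C| + 1) * (e / (`|C| + 1)) by rewrite mulrC divfK ?gt_eqF.
apply: (level_le_shift hp _ l _ _ _ _ (n - n1)%N%:Z _ _ _ small1).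
- exact: ltW.
- by rewrite ltW// divr_gt0.
- move=> j; rewrite weighted_abs_iter weighted_absE// mulrA.
  by rewrite ler_wpM2r ?modulus_ge0// bound// subn_gt0.
Qed.

(** For [f] the level-[k] weight of an iterate, this is the continuity estimate of that iterate at
    level [k]. *)
Definition dominated (f : int -> R) : Prop :=
  exists l C, 0 <= C /\ forall m, f m <= C * A m l.

Lemma dominated_sum n (f : nat -> int -> R) :
  (forall i, dominated (f i)) -> dominated (fun m => \sum_(i < n) f i m).
Proof.
move=> fdom; elim: n => [|n [l [C [C0 Cl]]]].
  by exists 0%N, 0; split=> // m; rewrite big_ord0 mul0r.
have [l' [C' [C'0 C'l]]] := fdom n.
exists (maxn l l'), (C + C'); split=> [|m]; first exact: addr_ge0.
rewrite big_ord_recr/= mulrDl lerD//.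
  by apply: le_trans (Cl m) _; rewrite ler_wpM2l// Amono// leq_maxl.
by apply: le_trans (C'l m) _; rewrite ler_wpM2l// Amono// leq_maxr.
Qed.

(** If no estimate held, a gliding hump would give a vector of the space whose image has unbounded
    weighted coordinates at level [k], so that [B] would leave the space. *)
Lemma orbit_weight1_dominated k :
  (forall x, koethe_space p A x -> koethe_space p A (B x)) ->
  dominated (fun m => orbit_weight m 1 k).
Proof.
move=> hB; apply: contrapT => ndom.
have [|z [z0 zX unb]] := exists_unbounded_values _ _ (fun m => orbit_weight m 1 k) A0 Amono.
  move=> l C; apply: contrapT => /forallNP none; apply: ndom; exists l, `|C|.
  split=> // m; rewrite (@le_trans _ _ (C * A m l)) ?ler_wpM2r ?ler_norm ?(ltW (A0 _ _))//.
  by rewrite leNgt; apply/negP; exact: none.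
pose x m := of_real c (z m).
have xE m : modulus (x m) = z m by rewrite modulus_of_real ger0_norm.
have /(koethe_space_bounded hp _ k)[e xe] : koethe_space p A (B x).
  apply: hB; apply: (koethe_space_sums hp) => l; have [e ze] := zX l; exists e => s us.
  apply: le_trans (ze s us); apply: ler_sum => m _.
  by rewrite weighted_absE// xE mulrC.
have [m] := unb e; apply/negP; rewrite -leNgt.
have := xe (m - 1); rewrite -[B x]/(iter 1 B x) weighted_abs_iter subrK xE.
by rewrite mulrC.
Qed.

Lemma orbit_weight_dominated n k :
  (forall x, koethe_space p A x -> koethe_space p A (B x)) ->
  dominated (fun m => orbit_weight m n k).
Proof.
move=> hB; elim: n => [|n [l [C [C0 Cl]]]].
  by exists k, 1; split=> // m; rewrite orbit_weight0 mul1r.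
have [l' [C' [C'0 C'l]]] := orbit_weight1_dominated l hB.
exists l', (C * C'); split=> [|m]; first exact: mulr_ge0.
rewrite -add1n orbit_weightD big_ord1 addr0.
rewrite (@le_trans _ _ (C * orbit_weight m 1 l))//.
  by rewrite [in leRHS]/orbit_weight big_ord1 addr0 mulrA ler_wpM2r ?modulus_ge0.
by rewrite -mulrA ler_wpM2l.
Qed.

Lemma exists_semi_irregular :
  (forall x, koethe_space p A x -> koethe_space p A (B x)) ->
  (forall k N e, 0 < e -> exists2 n, (N <= n)%N & orbit_weight 0 n k <= e) ->
  (exists k, forall l C, exists m n, (0 < n)%N /\ C * A m l < orbit_weight m n k) ->
  exists x, [/\ koethe_space p A x, frequently_small x & frequently_large x].
Proof.
move=> hB freq [k0 unb].
(* It suffices to find nonnegative real coordinates with l^1 bounds from above and one large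
   coordinate from below. *)
suff [z [z0 zX zsmall [k [e [e0 zlarge]]]]] : exists z : int -> R,
    [/\ forall m, 0 <= z m,
    forall k, exists e, sums_le (fun m => z m * orbit_weight m 0 k) e,
    forall k N e, 0 < e -> exists2 n, (N <= n)%N &
      sums_le (fun m => z m * orbit_weight m n k) e &
    exists k e, 0 < e /\
      forall N, exists n m, (N <= n)%N /\ e < z m * orbit_weight m n k].
  pose x m := of_real c (z m).
  have xE m : modulus (x m) = z m by rewrite modulus_of_real ger0_norm.
  have sums n l r : sums_le (fun m => z m * orbit_weight m n l) r ->
      sums_le (weighted_abs A l (iter n B x)) r.
    rewrite -[r in X in _ -> X]mul1r; apply: (sums_le_shift _ _ _ _ n%:Z) => // j.
    by rewrite mul1r weighted_abs_iter xE mulrC.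
  exists x; split.
  - apply: (koethe_space_sums hp) => // l; have [r zr] := zX l.
    by exists r; exact: (sums 0%N).
  - move=> l N r r0; have [n Nn zn] := zsmall l N r r0; exists n => //.
    by apply: (level_le_sums hp) => //; exact: sums.
  - exists k, e; split=> // N; have [n [m [Nn zn]]] := zlarge N; exists n => //.
    move=> /(level_le_coord hp _ _ _ (m - n%:Z) (ltW e0)).
    by apply/negP; rewrite -ltNge weighted_abs_iter subrK xE mulrC.
have [cvg0|ncvg] := pselect (forall k e, 0 < e ->
    exists N, forall n, (N <= n)%N -> orbit_weight 0 n k <= e); last first.
  exists (fun m => (m == 0)%:R); split=> [m|k|k N e e0|].
  - by rewrite ler0n.
  - by exists (orbit_weight 0 0 k); apply/sums_le_delta/ltW/orbit_weight_gt0.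
  - have [n Nn ne] := freq k N e e0; exists n => // s us; apply: le_trans ne.
    by apply: (sums_le_delta (fun m => orbit_weight m n k)) us; exact/ltW/orbit_weight_gt0.
  - move: ncvg => /existsNP[k /existsNP[e /not_implyP[e0 /forallNP large]]].
    exists k, e; split=> // N; have /existsNP[n /not_implyP[Nn /negP]] := large N.
    by rewrite -ltNge => lt; exists n, 0; rewrite eqxx mul1r.
have [||q C|z [z0 zX zsmall zlarge]] :=
    exists_semi_irregular_values _ (fun m n k => orbit_weight m n k) k0.
- exact: orbit_weight_gt0.
- by move=> m k; apply: (orbit_weight_eventually 0); exact: cvg0.
- have [l [D [D0 Dl]]] : dominated (fun m =>
      \sum_(i < q.+1) \sum_(k < q.+1) orbit_weight m i k).
    apply: (dominated_sum _ (fun i m => \sum_(k < q.+1) orbit_weight m i k)) => i.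
    apply: (dominated_sum _ (fun k m => orbit_weight m i k)) => k.
    exact: orbit_weight_dominated.
  (* The double sum is at most [D * A m l], so unboundedness relative to level [l] beats [C] times
     it. *)
  have [m [n [_ mn]]] := unb l (`|C| * D); exists m, n; apply: le_lt_trans mn.
  rewrite -mulrA; apply: (@le_trans _ _ (`|C| *
      \sum_(i < q.+1) \sum_(k < q.+1) orbit_weight m i k)).
    rewrite ler_wpM2r ?ler_norm//; do 2!apply: sumr_ge0 => ? _.
    exact/ltW/orbit_weight_gt0.
  by rewrite ler_wpM2l.
exists z; split=> // [k N e e0|].
  by have [n Nn zn] := zsmall k N e e0; exists n => //; exact: zn.
(* A strict lower bound is required, so the value 1 attained is weakened to 1/2. *)
exists k0, 2^-1; split=> // N; have [n [m [Nn zn]]] := zlarge N.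
by exists n, m; split=> //; apply: lt_le_trans zn; rewrite invf_lt1// ltr1n.
Qed.

End ShiftOrbits.

(** * Li-Yorke pairs *)

Section LimInfSup.
Context {R : realType}.
Variable u : nat -> R.
Hypothesis u0 : forall n, 0 <= u n.

Lemma limn_einf_eq0P : limn_einf (fun n => (u n)%:E) = 0%E <->
  forall N e, 0 < e -> exists2 n, (N <= n)%N & u n < e.
Proof.
rewrite limn_einf_lim (cvg_lim _ (@cvg_einfs_sup _ _))//; split=> [inf0 N e e0|h].
  apply: contrapT => none.
  have : (e%:E <= einfs (fun n => (u n)%:E) N)%E.
    apply: le_ereal_inf_tmp => _ [n /= Nn <-]; rewrite lee_fin leNgt.
    by apply/negP => une; apply: none; exists n.
  have : (einfs (fun n => (u n)%:E) N <= 0)%E.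
    by rewrite -inf0; apply: ereal_sup_ubound; exists N.
  by move=> /[swap] /le_trans /[apply]; rewrite lee_fin leNgt e0.
apply/eqP; rewrite eq_le; apply/andP; split.
  apply: ge_ereal_sup => _ [N _ <-]; apply/lee_addgt0Pr => e e0; rewrite add0e.
  have [n Nn une] := h N e e0.
  apply: (@le_trans _ _ (u n)%:E); last by rewrite lee_fin ltW.
  by apply: ereal_inf_lbound; exists n.
apply: (@le_trans _ _ (einfs (fun n => (u n)%:E) 0)).
  by apply: le_ereal_inf_tmp => _ [n _ <-]; rewrite lee_fin.
by apply: ereal_sup_ubound; exists 0%N.
Qed.

Lemma limn_esup_gt0P : (0 < limn_esup (fun n => (u n)%:E))%E <->
  exists2 e, 0 < e & forall N, exists2 n, (N <= n)%N & e <= u n.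
Proof.
rewrite limn_esup_lim (cvg_lim _ (@cvg_esups_inf _ _))//; split=> [sup0|[e e0 h]].
  apply: contrapT => none; move: sup0; apply/negP; rewrite -leNgt.
  apply/lee_addgt0Pr => e e0; rewrite add0e.
  have [N uN] : exists N, forall n, (N <= n)%N -> u n < e.
    apply: contrapT => /forallNP noN; apply: none; exists e => // N.
    have /existsNP[n /not_implyP[Nn /negP]] := noN N.
    by rewrite -leNgt => eu; exists n.
  apply: (@le_trans _ _ (esups (fun n => (u n)%:E) N)).
    by apply: ereal_inf_lbound; exists N.
  by apply: ge_ereal_sup => _ [n /= Nn <-]; rewrite lee_fin ltW// uN.
apply: (@lt_le_trans _ _ e%:E); first by rewrite lte_fin.
apply: le_ereal_inf_tmp => _ [N _ <-]; have [n Nn eu] := h N.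
apply: (@le_trans _ _ (u n)%:E); first by rewrite lee_fin.
by apply: ereal_sup_ubound; exists n.
Qed.

End LimInfSup.

(** A countable set has Lebesgue measure 0, but the unit interval has measure 1. *)
Lemma uncountable_setT (R : realType) : ~ countable [set: R].
Proof.
move=> cR; have : countable (`[0%R, 1%R]%classic : set R).
  by apply: sub_countable cR; exact: subset_card_le.
move/countable_lebesgue_measure0; rewrite lebesgue_measure_itv/= lte_fin ltr01.
by rewrite oppr0 adde0 => -[]/eqP; rewrite oner_eq0.
Qed.

Section LiYorkePairs.
Context {R : realType} {c : scalar_kind} {p : R} {A : int -> nat -> R}.
Context {w : int -> scalar_field R c}.
Context {d : (int -> scalar_field R c) -> (int -> scalar_field R c) -> R}.
Hypotheses (hp : p = 0 \/ 1 <= p) (A0 : forall j k, 0 < A j k).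
Hypothesis Amono : forall j k l, (k <= l)%N -> A j k <= A j l.
Hypothesis hB : forall x, koethe_space p A x -> koethe_space p A (weighted_shift w x).
Hypothesis hd : compatible_metric p A d.
Local Notation K := (scalar_field R c).
Local Notation X := (@koethe_space R c p A).
Local Notation B := (weighted_shift w).
Local Notation level_le := (@level_le R c p A).
Local Notation frequently_small := (@frequently_small R c p A w).
Local Notation frequently_large := (@frequently_large R c p A w).
Implicit Types (x y z : int -> K).

Lemma level_le_metric_small e : 0 < e -> exists k e', 0 < e' /\
  forall y, X y -> level_le k y e' -> d 0 y < e.
Proof.
move=> e0; have [_ _ /(_ 0 [set y | d 0 y < e] (koethe_space0 hp A0))[_]] := hd.
case; first by exists e.
(* Halving [e'] turns the weak inequality of [level_le] into the strict one of the neighbourhood. *)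
move=> k [e' [e'0 small]]; exists k, (e' / 2); split=> [|y yX ye].
  by rewrite divr_gt0.
apply: small => // l lk; rewrite subr0.
apply: (@le_lt_trans _ _ (e' / 2)%:E); last by rewrite lte_fin; lra.
by apply/(koethe_seminorm_leP hp); [|apply: (level_le_mono hp A0 Amono _ _ _ _ lk _ ye)]; lra.
Qed.

Lemma metric_small_level_le k e : 0 < e -> exists2 e', 0 < e' &
  forall y, X y -> d 0 y < e' -> level_le k y e.
Proof.
move=> e0.
have [_ _ /(_ 0 [set y | level_le k y e] (koethe_space0 hp A0))[+ _]] := hd.
case=> [|e' [e'0 small]]; last by exists e'.
exists k, e; split=> // y yX /(_ k (leqnn k)); rewrite subr0 => /ltW.
by move/(koethe_seminorm_leP hp); apply; exact: ltW.
Qed.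

Lemma iter_weighted_shiftB n x y : iter n B (y - x) = iter n B y - iter n B x.
Proof.
apply/funext => j; rewrite iter_weighted_shiftE mulrBr.
by rewrite -!iter_weighted_shiftE.
Qed.

Lemma iter_weighted_shiftZ n x (a : K) :
  iter n B (fun j => a * x j) = fun j => a * iter n B x j.
Proof. by apply/funext => j; rewrite !iter_weighted_shiftE mulrCA. Qed.

Lemma metric_translate x y : X x -> X y -> d x y = d 0 (y - x).
Proof.
move=> xX yX; have [_ trans _] := hd; rewrite -(trans x y (- x)) ?subrr//.
rewrite -sub0r; apply: (koethe_spaceB hp A0) => //; exact: koethe_space0.
Qed.

(** Linearity and translation invariance reduce the pair to the distance from 0 of the orbit of
    [y - x]; near 0 the metric and the seminorms control each other. *)
Lemma li_yorke_pairP x y : X x -> X y ->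
  (limn_einf (fun n => (d (iter n B x) (iter n B y))%:E) = 0%E /\
   (0 < limn_esup (fun n => (d (iter n B x) (iter n B y))%:E))%E) <->
  (frequently_small (y - x) /\ frequently_large (y - x)).
Proof.
move=> xX yX.
have itX z n : X z -> X (iter n B z).
  by move=> zX; exact: iter_weighted_shift_koethe_space.
have zX : X (y - x) by exact: (koethe_spaceB hp A0).
have -> : (fun n => (d (iter n B x) (iter n B y))%:E) =
    (fun n => (d 0 (iter n B (y - x)))%:E).
  apply/funext => n; rewrite iter_weighted_shiftB metric_translate//; exact: itX.
have d0 n : 0 <= d 0 (iter n B (y - x)).
  by have [[dge _ _ _] _ _] := hd; apply: dge; [exact: koethe_space0|exact: itX].
rewrite limn_einf_eq0P// limn_esup_gt0P//.
split=> -[small large]; split.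
- move=> k N e e0; have [e' e'0 de'] := metric_small_level_le k e e0.
  by have [n Nn dn] := small N e' e'0; exists n => //; apply: de' => //; exact: itX.
- have [e e0 dlarge] := large; have [k [e' [e'0 de']]] := level_le_metric_small e e0.
  exists k, e'; split=> // N; have [n Nn dn] := dlarge N; exists n => //.
  move=> /(de' _ (itX _ _ zX)); apply/negP; by rewrite -leNgt.
- move=> N e e0; have [k [e' [e'0 de']]] := level_le_metric_small e e0.
  by have [n Nn dn] := small k N e' e'0; exists n => //; apply: de' => //; exact: itX.
- have [k [e [e0 dlarge]]] := large; have [e' e'0 de'] := metric_small_level_le k e e0.
  exists e' => // N; have [n Nn dn] := dlarge N; exists n => //.
  rewrite leNgt; apply/negP => dlt; apply: dn; apply: de' => //; exact: itX.
Qed.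

Lemma frequently_small_scale x (a : K) : a <> 0 -> frequently_small x ->
  frequently_small (fun j => a * x j).
Proof.
move=> /modulus_gt0 a0 small k N e e0.
have [n Nn xn] := small k N (e / modulus a) (divr_gt0 e0 a0); exists n => //.
rewrite iter_weighted_shiftZ -[e](divfK (lt0r_neq0 a0)) mulrC.
by apply: (level_le_scale hp A0) => //; rewrite ltW// divr_gt0.
Qed.

Lemma frequently_large_scale x (a : K) : a <> 0 -> frequently_large x ->
  frequently_large (fun j => a * x j).
Proof.
move=> a_neq0 [k [e [e0 large]]]; have a0 := modulus_gt0 _ a_neq0.
exists k, (modulus a * e); split=> [|N]; first exact: mulr_gt0.
have [n Nn xn] := large N; exists n => // axn; apply: xn.
rewrite iter_weighted_shiftZ in axn.
have := level_le_scale hp A0 _ _ _ a^-1 (ltW (mulr_gt0 a0 e0)) axn.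
have va : a^-1 * a = 1 by rewrite mulVf//; exact/eqP.
rewrite mulrA -modulusM va modulus1 mul1r.
by under eq_fun do rewrite mulrA va mul1r.
Qed.

Lemma li_yorke_chaoticP : li_yorke_chaotic X d B <->
  exists x, [/\ X x, frequently_small x & frequently_large x].
Proof.
split=> [[S [SX Sunc chaos]]|[z [zX small large]]].
  have [x [y [Sx Sy xy]]] : exists x y, [/\ S x, S y & x <> y].
    apply: contrapT => none; apply: Sunc.
    have [->|/set0P[x Sx]] := eqVneq S set0; first exact: countable0.
    suff -> : S = [set x] by exact: countable1.
    apply/seteqP; split=> [y Sy|_ ->//]; apply: contrapT => yx.
    by apply: none; exists y, x.
  have [xX yX] := (SX _ Sx, SX _ Sy); exists (y - x).
  have /(li_yorke_pairP _ _ xX yX)[] := chaos x y Sx Sy xy.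
  by split=> //; exact: (koethe_spaceB hp A0).
(* Differences of distinct points of this real line are nonzero real multiples of [z], so every pair
   inherits its behaviour. *)
pose f t : int -> K := fun j => of_real c t * z j.
have fX t : X (f t) by exact: (koethe_space_scale A0).
have of_real_neq0 (t : R) : t <> 0 -> of_real c t <> 0.
  move=> t0 ct0; apply: t0; apply/normr0_eq0.
  by rewrite -(modulus_of_real (c := c)) ct0 modulus0.
have fB s t : f t - f s = fun j => of_real c (t - s) * z j.
  by apply/funext => j; rewrite of_realB mulrBl.
exists (range f); split=> [_ [t _ <-]//|cf|_ _ [s _ <-] [t _ <-] fst].
- apply: (@uncountable_setT R); apply/countable_injP.
  have /countable_injP[g ginj] := cf; exists (g \o f) => s t _ _ gst.
  have {gst} fst : f s = f t by apply: ginj gst; rewrite inE; [exists s|exists t].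
  apply: contrapT => /eqP; rewrite -subr_eq0 => /eqP /of_real_neq0 st.
  (* A nonzero coordinate of [z] makes [f] injective, so the line is uncountable. *)
  have [m zm] := frequently_large_neq0 A0 hp _ large.
  have /eqP : of_real c (s - t) * z m = 0.
    by rewrite -[LHS]/((fun j => of_real c (s - t) * z j) m) -fB fst subrr.
  by rewrite mulf_eq0 => /orP[] /eqP.
- have st : t - s <> 0 by move=> /eqP; rewrite subr_eq0 => /eqP ts; apply: fst; rewrite ts.
  apply/(li_yorke_pairP _ _ (fX s) (fX t)); rewrite fB; split.
    by apply: frequently_small_scale => //; exact: of_real_neq0.
  by apply: frequently_large_scale => //; exact: of_real_neq0.
Qed.

End LiYorkePairs.

(** * The characterization of Li-Yorke chaos for the weighted shift *)

Theorem theorem24 (R : realType) (c : scalar_kind) (p : R)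
    (A : int -> nat -> R) (w : int -> scalar_field R c)
    (d : (int -> scalar_field R c) -> (int -> scalar_field R c) -> R)
    (hp : p = 0 \/ 1 <= p)
    (hA : koethe_matrix A)
    (hA0 : forall j k, A j k <> 0)
    (hw : forall n, w n <> 0)
    (hB : forall x, koethe_space p A x -> koethe_space p A (weighted_shift w x))
    (hd : compatible_metric p A d) :
  li_yorke_chaotic (koethe_space p A) d (weighted_shift w) <->
  (exists n : nat -> nat,
      [/\ forall i, (0 < n i)%N,
          forall i, (n i < n i.+1)%N
        & forall k : nat,
            (fun i : nat =>
               modulus (of_real c (A (- (n i)%:Z) k)
                        * weight_prod w (- (n i)%:Z) (-1)))
              @ \oo --> (0 : R)]) /\
  (exists k : nat, forall l : nat,
      ereal_sup [set r : \bar R | exists i j : int, i <= j /\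
         r = (A i k * modulus (weight_prod w i j) / A (j + 1) l)%:E]
      = +oo%E).
Proof.
have [_ hA2] := hA.
have A0 j k : 0 < A j k by rewrite lt_def; have [-> _] := hA2 j k; rewrite andbT; exact/eqP.
have Amono j k l : (k <= l)%N -> A j k <= A j l.
  elim: l => [|l IH]; first by rewrite leqn0 => /eqP ->.
  rewrite leq_eqVlt => /predU1P[->//|/IH /le_trans]; apply.
  by have [] := hA2 j l.
rewrite (li_yorke_chaoticP hp A0 Amono hB hd) (condition_aP A0 hw Amono).
split=> [[x [_ small large]]|[freq [k supoo]]].
  split; first exact: (orbit_weight_frequently_small A0 hw hp _ small large).
  have [k unb] := orbit_weight_unbounded A0 hp _ small large.
  by exists k => l; apply/(condition_bP A0); exact: unb.
apply: (exists_semi_irregular A0 hw Amono hp hB freq); exists k => l.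
exact/(condition_bP A0).
Qed.
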